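(* Let $Q$ be a convex polygon with no two adjacent edges collinear, let $p(Q)$ be the number of unordered pairs of parallel edges of $Q$, and let $\operatorname{Pyr}(Q)\subset\mathbb R^3$ be any pyramid over $Q$ (the convex hull of $Q$, placed in an affine plane, and an apex outside that plane). Then \[ \delta(\operatorname{Pyr}(Q))=2p(Q). \] Consequently, $\operatorname{Pyr}(Q)$ has zero defect, i.e. $\delta(\operatorname{Pyr}(Q))=0$, if and only if $Q$ has no pair of parallel edges.
   Context: A convex polyhedron $P\subset\mathbb R^3$ means a compact full-dimensional convex polytope. Two points of $P$ are antipodal if there are two parallel supporting planes of $P$, one through each point, that contain $P$ between them. $V(P)$ is the number of vertices of $P$; $A(P)$ is the number of unordered pairs of distinct vertices of $P$ that are antipodal; $B(P)$ is the number of unordered pairs of distinct edges of $P$ whose midpoints are antipodal. The antipodal defect is $\delta(P)=V(P)-1-A(P)+B(P)$. ''Pair of parallel edges'' means an unordered pair of distinct parallel edges. *)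

(* Defs.v *)
From HB Require Import structures.
From mathcomp Require Import all_boot all_order all_algebra finmap.
From mathcomp Require Import all_classical reals convex.

Set Implicit Arguments.
Unset Strict Implicit.
Unset Printing Implicit Defensive.

Import Order.TTheory GRing.Theory Num.Theory.

Local Open Scope classical_set_scope.
Local Open Scope ring_scope.

Definition dot (R : realType) (d : nat) (u v : 'rV[R]_d) : R :=
  \sum_(i < d) u 0 i * v 0 i.

Definition conv_hull (R : realType) (d : nat) (X : set 'rV[R]_d) :
    set 'rV[R]_d :=
  smallest (@convex_set R 'rV[R]_d) X.

Definition segment (R : realType) (d : nat) (x y : 'rV[R]_d) : set 'rV[R]_d :=
  [set z | exists2 t : R, 0 <= t <= 1 & z = (1 - t) *: x + t *: y].

Definition midpoint (R : realType) (d : nat) (x y : 'rV[R]_d) : 'rV[R]_d :=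
  2^-1 *: (x + y).

(* Faces are taken in the sense of polytope theory: the set of points of P
   where some linear functional attains its maximum over P.  The trivial
   functional c = 0 only yields F = P. *)
Definition face (R : realType) (d : nat) (P F : set 'rV[R]_d) : Prop :=
  F !=set0 /\
  exists (c : 'rV[R]_d) (a : R),
    (forall z, P z -> dot c z <= a) /\ F = P `&` [set z | dot c z = a].

Definition vertex (R : realType) (d : nat) (P : set 'rV[R]_d) (x : 'rV[R]_d) :
    Prop :=
  face P [set x].

Definition edge (R : realType) (d : nat) (P F : set 'rV[R]_d) : Prop :=
  face P F /\ exists x y : 'rV[R]_d, x != y /\ F = segment x y.

(* The parallel planes are {z | dot c z = a} and {z | dot c z = b}; replacing
   (c, a, b) by (- c, - b, - a) shows that the relation is symmetric.  For a
   full-dimensional P the two planes are necessarily distinct. *)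
Definition antipodal (R : realType) (d : nat) (P : set 'rV[R]_d)
    (x y : 'rV[R]_d) : Prop :=
  [/\ P x, P y &
    exists (c : 'rV[R]_d) (a b : R),
      [/\ c != 0, dot c x = a, dot c y = b &
        forall z, P z -> a <= dot c z <= b]].

Definition antipodal_midpoints (R : realType) (d : nat)
    (P E F : set 'rV[R]_d) : Prop :=
  exists x y x' y' : 'rV[R]_d,
    [/\ E = segment x y, F = segment x' y' &
      antipodal P (midpoint x y) (midpoint x' y')].

(* The three counts below use fset_set, which agrees with the given set when
   that set is finite (it is empty otherwise); a polytope has finitely many
   vertices and edges.  Unordered pairs are represented by doubletons. *)
Definition num_vertices (R : realType) (d : nat) (P : set 'rV[R]_d) : nat :=
  #|` fset_set [set x | vertex P x] |.

Definition num_antipodal_vertices (R : realType) (d : nat)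
    (P : set 'rV[R]_d) : nat :=
  #|` fset_set [set S : set 'rV[R]_d | exists x y : 'rV[R]_d,
        [/\ vertex P x, vertex P y, x <> y, antipodal P x y &
            S = [set x; y]]] |.

Definition num_antipodal_edges (R : realType) (d : nat)
    (P : set 'rV[R]_d) : nat :=
  #|` fset_set [set S : set (set 'rV[R]_d) | exists E F : set 'rV[R]_d,
        [/\ edge P E, edge P F, E <> F, antipodal_midpoints P E F &
            S = [set E; F]]] |.

Definition defect (R : realType) (P : set 'rV[R]_3) : int :=
  (num_vertices P)%:Z - 1 - (num_antipodal_vertices P)%:Z
  + (num_antipodal_edges P)%:Z.

Definition cross (R : realType) (u v : 'rV[R]_2) : R :=
  u 0 0 * v 0 1 - u 0 1 * v 0 0.

(* A polygon is given by its cyclic sequence of vertices.  It is convex when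
   the vertices are distinct, not all collinear, and lie in this cyclic order
   (of either orientation) on the boundary of their convex hull.  Flat
   vertices, i.e. collinear adjacent edges, are allowed. *)
Definition convex_polygon (R : realType) (n : nat) (q : 'I_n -> 'rV[R]_2) :
    Prop :=
  let orient i j k := cross (q j - q i) (q k - q i) in
  [/\ (2 < n)%N,
      injective q,
      exists i j k : 'I_n, orient i j k != 0 &
      (forall i j k : 'I_n, (i < j < k)%N -> 0 <= orient i j k) \/
      (forall i j k : 'I_n, (i < j < k)%N -> orient i j k <= 0)].

(* Edge i of the polygon joins q i to its cyclic successor q (ordS i). *)
Definition edge_vector (R : realType) (n : nat) (q : 'I_n -> 'rV[R]_2)
    (i : 'I_n) : 'rV[R]_2 :=
  q (ordS i) - q i.

Definition parallel_edges (R : realType) (n : nat) (q : 'I_n -> 'rV[R]_2)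
    (i j : 'I_n) : bool :=
  cross (edge_vector q i) (edge_vector q j) == 0.

(* Edges i and ordS i share a vertex, so they are collinear as soon as their
   directions are parallel. *)
Definition no_adjacent_collinear (R : realType) (n : nat)
    (q : 'I_n -> 'rV[R]_2) : Prop :=
  forall i : 'I_n, ~~ parallel_edges q i (ordS i).

Definition num_parallel_edges (R : realType) (n : nat)
    (q : 'I_n -> 'rV[R]_2) : nat :=
  #|[set ij : 'I_n * 'I_n | (ij.1 < ij.2)%N && parallel_edges q ij.1 ij.2]%SET|.

Definition polygon_region (R : realType) (n : nat) (q : 'I_n -> 'rV[R]_2) :
    set 'rV[R]_2 :=
  conv_hull (range q).

(* The affine map from the plane to space that places the polygon; it is
   injective when M has rank 2. *)
Definition place (R : realType) (o : 'rV[R]_3) (M : 'M[R]_(2, 3))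
    (x : 'rV[R]_2) : 'rV[R]_3 :=
  o + x *m M.

Definition pyramid (R : realType) (n : nat) (q : 'I_n -> 'rV[R]_2)
    (o : 'rV[R]_3) (M : 'M[R]_(2, 3)) (apex : 'rV[R]_3) : set 'rV[R]_3 :=
  conv_hull (place o M @` polygon_region q `|` [set apex]).

(* Main.v *)
Require Import Defs.
From HB Require Import structures.
From mathcomp Require Import all_boot all_order all_algebra finmap.
From mathcomp Require Import all_classical reals interval_inference convex.
From mathcomp Require Import ring lra zify.

Set Implicit Arguments.
Unset Strict Implicit.
Unset Printing Implicit Defensive.

Import Order.TTheory GRing.Theory Num.Theory.

Local Open Scope classical_set_scope.
Local Open Scope ring_scope.

(** Since the polygon has [n] vertices, the pyramid has [n + 1]. Write [far i j]
    when vertex [j] is at maximal distance from the line of edge [i]. Extending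
    functionals from the base plane to the apex shows that
    - the apex is antipodal to each base vertex, and two base vertices are
      antipodal iff they are so in the polygon, i.e. iff [far i j] or [far j i]
      (rotate a strip until it rests on an edge);
    - the midpoints of two base edges are antipodal iff the edges are parallel,
      those of base edge [i] and lateral edge [j] iff [far i j], and those of
      two lateral edges never.
    As [far i j] and [far j i] hold together exactly for distinct parallel edges,
    the ordered counts give [2A = 2n + 2F - 2p] and [2B = 2p + 2F] with [F] the
    number of pairs [far i j], and [F] cancels in the defect. *)

(** * Strictly convex polygons *)

Section Cross.
Variable R : realType.
Implicit Types u v w x : 'rV[R]_2.

Lemma row2P u v : u 0 0 = v 0 0 -> u 0 1 = v 0 1 -> u = v.
Proof.
move=> uv0 uv1; apply/rowP; case=> -[|[|//]] i2.
- by rewrite (_ : Ordinal i2 = 0)//; apply: val_inj.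
- by rewrite (_ : Ordinal i2 = 1)//; apply: val_inj.
Qed.

Lemma crossvv u : cross u u = 0. Proof. by rewrite /cross; ring. Qed.

Lemma crossC u v : cross u v = - cross v u. Proof. by rewrite /cross; ring. Qed.

Lemma cross0l u : cross 0 u = 0. Proof. by rewrite /cross !mxE; ring. Qed.

Lemma cross0r u : cross u 0 = 0. Proof. by rewrite /cross !mxE; ring. Qed.

Lemma crossDr u v w : cross u (v + w) = cross u v + cross u w.
Proof. by rewrite /cross !mxE; ring. Qed.

Lemma crossBr u v w : cross u (v - w) = cross u v - cross u w.
Proof. by rewrite /cross !mxE; ring. Qed.

Lemma crossDl u v w : cross (u + v) w = cross u w + cross v w.
Proof. by rewrite /cross !mxE; ring. Qed.

Lemma crossNl u w : cross (- u) w = - cross u w.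
Proof. by rewrite /cross !mxE; ring. Qed.

Lemma crossZr a u v : cross u (a *: v) = a * cross u v.
Proof. by rewrite /cross !mxE; ring. Qed.

Lemma crossZl a u v : cross (a *: u) v = a * cross u v.
Proof. by rewrite /cross !mxE; ring. Qed.

(** The three-term Plücker relation. Each product carries [s] twice because signs are known only for
    [s * cross]. *)
Lemma cross_plucker s u v w x :
  (s * cross u v) * (s * cross w x) =
  (s * cross w v) * (s * cross u x) + (s * cross u w) * (s * cross v x).
Proof. by rewrite /cross; ring. Qed.

Lemma cross_eq0P u v : u != 0 -> cross u v = 0 -> exists a, v = a *: u.
Proof.
move=> u0 uv.
have [u00|u00] := eqVneq (u 0 0) 0; last first.
  exists (v 0 0 / u 0 0); apply: row2P; rewrite !mxE ?divfK//.
  by apply: (mulfI u00); move: uv; rewrite /cross => /subr0_eq ->; field.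
have u01 : u 0 1 != 0.
  by apply: contra_neq u0 => u01; apply: row2P; rewrite !mxE.
exists (v 0 1 / u 0 1); apply: row2P; rewrite !mxE ?divfK//.
by apply: (mulfI u01); move: uv; rewrite /cross => /subr0_eq <-; field.
Qed.

End Cross.

(* The factor [s] lets both orientations of the polygon be treated at once. *)
Section ConvexPolygon.
Variables (R : realType) (n : nat) (q : 'I_n -> 'rV[R]_2) (s : R).
Hypotheses (q_inj : injective q) (s0 : s != 0).
Hypothesis q_adj : no_adjacent_collinear q.
Local Notation "[[ u , v ]]" := (s * cross u v).
Local Notation e := (edge_vector q).
Hypothesis q_left : forall i k, 0 <= [[e i, q k - q i]].

Let scross0 u v : [[u, v]] = 0 -> cross u v = 0.
Proof. by move/eqP; rewrite mulf_eq0 (negPf s0) => /eqP. Qed.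

Lemma ordS_neq i : ordS i != i :> 'I_n.
Proof.
apply: contraNneq (q_adj i) => Si.
by rewrite /parallel_edges Si crossvv.
Qed.

Lemma ordSS_neq i : ordS (ordS i) != i :> 'I_n.
Proof.
apply: contraNneq (q_adj i) => SSi; rewrite /parallel_edges /edge_vector SSi.
by rewrite -(opprB (q (ordS i))) crossC crossNl crossvv !oppr0.
Qed.

Lemma edge_vector_neq0 i : e i != 0.
Proof. by rewrite subr_eq0 inj_eq// ordS_neq. Qed.

(** [q_left] at the end of the next edge gives the weak sign; non-collinearity of adjacent edges
    makes it strict. *)
Lemma cross_edge_gt0 i : 0 < [[e i, e (ordS i)]].
Proof.
rewrite lt_def mulf_neq0 ?q_adj//=.
have := q_left i (ordS (ordS i)).
suff -> : q (ordS (ordS i)) - q i = e (ordS i) + e i.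
  by rewrite crossDr crossvv addr0.
by rewrite addrA subrK.
Qed.

(* A vertex in the interior of an edge would force both its incident edges
   to be parallel to that edge. *)
Lemma q_left_eq0 i k :
  [[e i, q k - q i]] = 0 -> k = i \/ k = ordS i.
Proof.
move=> /scross0/(cross_eq0P (edge_vector_neq0 i))[t qk].
have [->|ki] := eqVneq k i; first by left.
have [->|kSi] := eqVneq k (ordS i); first by right.
exfalso.
have t0 : t != 0.
  by apply: contraNneq ki => t0; rewrite -(inj_eq q_inj) -subr_eq0 qk t0 scale0r.
have qkS : q k - q (ordS i) = (t - 1) *: e i.
  rewrite scalerBl scale1r -qk /edge_vector opprB addrA subrK//.
have t1 : t - 1 != 0.
  apply: contraNneq kSi => t1.
  by rewrite -(inj_eq q_inj) -subr_eq0 qkS t1 scale0r.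
(* The neighbouring edges confine [q k], which is [q i + t *: e i]: the preceding one gives
   [0 <= t], the following one [t <= 1]. *)
have tge0 : 0 <= t.
  have := q_left (ord_pred i) k; have := cross_edge_gt0 (ord_pred i).
  have -> : q k - q (ord_pred i) = t *: e i + e (ord_pred i).
    by rewrite -qk /edge_vector ord_predK addrA subrK.
  by rewrite (crossDr _ (t *: _)) crossvv addr0 crossZr ord_predK; nra.
have tle1 : t - 1 <= 0.
  have := q_left (ordS i) k; have := cross_edge_gt0 i.
  by rewrite qkS crossZr (crossC (e (ordS i))); nra.
(* If [q k] is on the line of edge [j], that line cannot separate the ends of edge [i], which lie on
   either side of [q k]; hence it is parallel to edge [i]. *)
have par j : [[e j, q k - q j]] = 0 -> cross (e i) (e j) = 0.
  move=> jk.
  have jkE w c : w = (q k - q j) - c *: e i -> [[e j, w]] = - (c * [[e j, e i]]).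
    by move=> ->; rewrite crossBr mulrBr jk sub0r crossZr mulrCA.
  have := q_left j i; have := q_left j (ordS i).
  rewrite (jkE (q i - q j) t); last by rewrite -qk opprB [RHS]addrC addrA subrK.
  rewrite (jkE (q (ordS i) - q j) (t - 1)); last first.
    by rewrite -qkS opprB [RHS]addrC addrA subrK.
  move=> h1 h2; rewrite crossC; apply/eqP; rewrite oppr_eq0; apply/eqP/scross0.
  have tgt0 : 0 < t by rewrite lt_def t0.
  have tlt1 : t - 1 < 0 by rewrite lt_neqAle t1.
  have : t * [[e j, e i]] <= 0 by rewrite -oppr_ge0.
  have : (t - 1) * [[e j, e i]] <= 0 by rewrite -oppr_ge0.
  rewrite nmulr_rle0// pmulr_rle0// => ge0 le0.
  by apply/eqP; rewrite eq_le le0.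
have := q_adj (ord_pred k); rewrite /parallel_edges ord_predK => /eqP; apply.
have park : cross (e i) (e (ord_pred k)) = 0.
  by apply: par; rewrite /edge_vector ord_predK crossvv mulr0.
have [a ->] := cross_eq0P (edge_vector_neq0 i) park.
by rewrite crossZl par ?mulr0// subrr cross0r mulr0.
Qed.

(** Ties are allowed, so both ends of another edge parallel to edge [i] are far from it. *)
Definition far i j := [forall k, [[e i, q k]] <= [[e i, q j]]].

Lemma edge_le i k : [[e i, q i]] <= [[e i, q k]].
Proof. by rewrite -subr_ge0 -mulrBr -crossBr. Qed.

Lemma parallel_edgesC i j : parallel_edges q i j = parallel_edges q j i.
Proof. by rewrite /parallel_edges crossC oppr_eq0. Qed.

(** Otherwise all vertices lie on the line of edge [i], and [ordS (ordS i)] would be one of its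
    ends. *)
Lemma far_irrefl i : ~~ far i i.
Proof.
apply/negP => /forallP/(_ (ordS (ordS i))).
rewrite -subr_le0 -mulrBr -crossBr => le0.
have /q_left_eq0[/eqP|/ordS_inj/eqP] : [[e i, q (ordS (ordS i)) - q i]] = 0.
- by apply/eqP; rewrite eq_le le0 q_left.
- by rewrite (negPf (ordSS_neq _)).
- by rewrite (negPf (ordS_neq _)).
Qed.

Lemma far_lt i j : far i j -> [[e i, q i]] < [[e i, q j]].
Proof.
move=> fij; rewrite lt_neqAle (forallP fij) andbT.
apply: contraNneq (far_irrefl i) => ij.
by apply/forallP => k; rewrite ij (forallP fij).
Qed.

(** Write [e i = a *: e j]. If [a <= 0], the condition [q_left] at edge [j] is the claim. If
    [a > 0], both lines support the polygon from the same side, so they coincide and [j] is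
    [ordS i], against [q_adj]. *)
Lemma parallel_far i j : i != j -> parallel_edges q i j -> far i j.
Proof.
move=> ij pij; apply/forallP => k; rewrite -subr_le0 -mulrBr -crossBr.
move: (pij); rewrite parallel_edgesC.
move=> /eqP/(cross_eq0P (edge_vector_neq0 j))[a ea].
have [a0|a0] := leP a 0.
  by rewrite ea crossZl; have := q_left j k; nra.
have /q_left_eq0[/eqP|ji] : [[e i, q j - q i]] = 0.
- have := q_left i j; have := q_left j i.
  by rewrite -opprB -scaleN1r !crossZr ea !crossZl; nra.
- by rewrite eq_sym (negPf ij).
- by have := q_adj i; rewrite -ji pij.
Qed.

(** Moving along edge [j] cannot increase the distance from edge [i], and conversely; this gives
    [[[e i, e j]]] both weak signs. *)
Lemma far_parallel i j : far i j -> far j i -> parallel_edges q i j.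
Proof.
move=> /forallP/(_ (ordS j)) fij /forallP/(_ (ordS i)) fji.
have le0 : [[e i, e j]] <= 0 by rewrite crossBr mulrBr subr_le0.
have ge0 : [[e j, e i]] <= 0 by rewrite crossBr mulrBr subr_le0.
apply/eqP/scross0/eqP; rewrite eq_le le0.
by move: ge0; rewrite crossC mulrN oppr_le0.
Qed.

(* Rotate the supporting lines with direction [d] counterclockwise until one
   of them reaches an edge: the sign of [e i, e j] tells which does first. *)
Lemma far_of_strip d i j :
    (forall k, [[d, q i]] <= [[d, q k]] <= [[d, q j]]) ->
    [[d, q i]] < [[d, q j]] -> [[e i, e j]] <= 0 ->
  far i j.
Proof.
move=> dk dij eij; apply/forallP => k; rewrite -subr_le0 -mulrBr -crossBr.
have dk0 : [[d, q k - q j]] <= 0.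
  by rewrite crossBr mulrBr subr_le0; case/andP: (dk k).
have dei : 0 <= [[d, e i]].
  by rewrite crossBr mulrBr subr_ge0; case/andP: (dk (ordS i)).
have dej : [[d, e j]] <= 0.
  by rewrite crossBr mulrBr subr_le0; case/andP: (dk (ordS j)).
(* Both products on the right of the relation are nonnegative, which settles the case [[[d, e j]] <
   0]. *)
have pl := cross_plucker s d (e j) (e i) (q k - q j).
have rhs := addr_ge0 (mulr_le0 eij dk0) (mulr_ge0 dei (q_left j k)).
move: dej; rewrite le_eqVlt => /orP[/eqP dej|dej]; last first.
  by rewrite -(nmulr_rge0 _ dej) pl.
(* The strip already rests on edge [j]. The signs then force [e i] to be a nonpositive multiple of
   [e j]. *)
have [b d_eq] : exists b, d = b *: e j.
  apply: (cross_eq0P (edge_vector_neq0 j)).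
  by rewrite crossC (scross0 dej) oppr0.
have b0 : b * [[e j, q i - q j]] < 0.
  by rewrite mulrCA -crossZl -d_eq crossBr mulrBr subr_lt0.
have ji := q_left j i.
have ji_gt0 : 0 < [[e j, q i - q j]].
  by rewrite lt_def ji andbT; apply: contraTneq b0 => ->; rewrite mulr0 ltxx.
have bneg : b < 0 by rewrite -(pmulr_llt0 _ ji_gt0).
have eij0 : cross (e j) (e i) = 0.
  apply: scross0; move: dei eij; rewrite d_eq crossZl (crossC (e i)).
  by move: (cross _ _) => c; nra.
have [m e_i] := cross_eq0P (edge_vector_neq0 j) eij0.
have m0 : m <= 0.
  have := q_left i j; rewrite e_i -opprB -scaleN1r crossZr crossZl.
  by move: ji_gt0; move: (cross _ _) => c; nra.
by rewrite e_i crossZl mulrCA; have := q_left j k; nra.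
Qed.

(** The edge vectors themselves span the strips. Conversely, the sign of [[[e i, e j]]] decides
    which edge is reached first, and negating [d] exchanges [i] and [j]. *)
Lemma farP i j :
  reflect (exists d, [[d, q i]] < [[d, q j]] /\
             forall k, [[d, q i]] <= [[d, q k]] <= [[d, q j]])
          (far i j || far j i).
Proof.
apply: (iffP orP) => [ [fij|fji] | [d [dij dk] ] ].
- exists (e i); split=> [|k]; first exact: far_lt.
  by rewrite edge_le (forallP fij).
- exists (- e j); split=> [|k]; rewrite !crossNl !mulrN.
    by rewrite ltrN2 far_lt.
  by rewrite !lerN2 edge_le (forallP fji).
- have [eij|eij] := leP [[e i, e j]] 0; first by left; apply: far_of_strip dij _.
  right; apply: (@far_of_strip (- d)) => [k||].
  + by rewrite !crossNl !mulrN !lerN2 andbC dk.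
  + by rewrite !crossNl !mulrN ltrN2.
  + by rewrite crossC mulrN oppr_le0 ltW.
Qed.

(** Up to exchanging [i] and [j], [q j - q i = t *: d] with [t <= 0]. Support along [d] and [q_left]
    at edge [i] then give [[[e i, q j - q i]]] opposite weak signs, so [q j] lies on the line of
    edge [i]. *)
Lemma support_adjacent d i j : d != 0 -> i != j ->
    [[d, q i]] = [[d, q j]] -> (forall k, [[d, q k]] <= [[d, q i]]) ->
  j = ordS i \/ i = ordS j.
Proof.
move=> d0; wlog [t [t0 qt] ] : i j / exists t, t <= 0 /\ q j - q i = t *: d.
  move=> wl ij dij dk.
  have [t qt] : exists t, q j - q i = t *: d.
    apply: cross_eq0P => //; apply: scross0.
    by rewrite crossBr mulrBr dij subrr.
  have [t0|t0] := leP t 0; first by apply: wl => //; exists t.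
  rewrite or_comm; apply: wl; rewrite 1?eq_sym// -?dij//.
  by exists (- t); rewrite oppr_le0 ltW// scaleNr -qt opprB.
move=> ij _ dk; left.
have : [[d, e i]] <= 0 by rewrite crossBr mulrBr subr_le0.
have := q_left i j; rewrite qt crossZr (crossC d) => h1 h2.
have /q_left_eq0[ji|//] : [[e i, q j - q i]] = 0.
  by rewrite qt crossZr; move: h1 h2; move: (cross _ _) => c; nra.
by rewrite ji eqxx in ij.
Qed.

End ConvexPolygon.

(** Here [s] is 1 or -1 according to the orientation. A cyclic rotation of [(i, ordS i, k)]
    preserves the cross product and makes the indices increasing, also when [ordS i] wraps around to
    0. *)
Lemma convex_polygon_left (R : realType) (n : nat) (q : 'I_n -> 'rV[R]_2) :
  convex_polygon q ->
  exists2 s : R, s != 0 &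
    forall i k, 0 <= s * cross (edge_vector q i) (q k - q i).
Proof.
move=> [_ _ _ or_q].
have [s s0 sP] : exists2 s : R, s != 0 & forall i j k : 'I_n, (i < j < k)%N ->
    0 <= s * cross (q j - q i) (q k - q i).
  case: or_q => or_q; [exists 1|exists (- 1)]; rewrite ?oppr_eq0 ?oner_eq0//.
    by move=> i j k ijk; rewrite mul1r or_q.
  by move=> i j k ijk; rewrite mulN1r oppr_ge0 or_q.
exists s => // i k.
have rot a b c : cross (q b - q a) (q c - q a) = cross (q c - q b) (q a - q b).
  by rewrite /cross !mxE; ring.
have [->|ki] := eqVneq k i; first by rewrite subrr cross0r mulr0.
have [->|kSi] := eqVneq k (ordS i); first by rewrite crossvv mulr0.
move: ki kSi; rewrite /edge_vector -!val_eqE /=.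
have [Sin|] := ltnP i.+1 n.
  rewrite modn_small// => ki kSi.
  have Si : ordS i = i.+1 :> nat by rewrite /= modn_small.
  have [ltik|leki] := ltnP i k; first by apply: sP; rewrite Si; lia.
  by rewrite rot rot; apply: sP; rewrite Si; lia.
move=> nSi ki; have iE : i.+1 = n by have := ltn_ord i; lia.
have Si : ordS i = 0%N :> nat by rewrite /= iE modnn.
rewrite iE modnn rot => k0; apply: sP; rewrite Si.
by have := ltn_ord k; lia.
Qed.

(** * Convex hulls of finite families *)

Section ConvHull.
Variables (R : realType) (d : nat).
Implicit Types (c x y z : 'rV[R]_d) (A X : set 'rV[R]_d).

Lemma dotE c x : dot c x = (x *m c^T) 0 0.
Proof. by rewrite mxE; apply: eq_bigr => i _; rewrite mxE mulrC. Qed.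

Lemma dotDr c x y : dot c (x + y) = dot c x + dot c y.
Proof. by rewrite !dotE mulmxDl mxE. Qed.

Lemma dotZr c a x : dot c (a *: x) = a * dot c x.
Proof. by rewrite !dotE -scalemxAl mxE. Qed.

Lemma dotNl c x : dot (- c) x = - dot c x.
Proof. by rewrite !dotE linearN mulmxN mxE. Qed.

Lemma dot_sum c (I : finType) (f : I -> 'rV[R]_d) :
  dot c (\sum_i f i) = \sum_i dot c (f i).
Proof. by rewrite dotE mulmx_suml summxE; apply: eq_bigr => i _; rewrite dotE. Qed.

Lemma dot_midpoint c x y : dot c (midpoint x y) = (dot c x + dot c y) / 2.
Proof. by rewrite dotZr dotDr mulrC. Qed.

Lemma convex_setP A :
  convex_set A <->
  forall x y t, 0 <= t <= 1 -> A x -> A y -> A (t *: x + (1 - t) *: y).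
Proof.
split=> [cA x y t /andP[t0 t1] Ax Ay|cA x y t].
  have := cA x y (Itv01 t0 t1); rewrite !inE; exact.
by rewrite !inE => Ax Ay; apply: (cA x y t%:num) => //; rewrite ge0 le1.
Qed.

Lemma convex_conv_hull X : convex_set (conv_hull X).
Proof.
apply/convex_setP => x y t t01 Xx Xy C [cC XC].
by apply: (convex_setP C).1 => //; [apply: Xx|apply: Xy].
Qed.

Lemma sub_conv_hull X : X `<=` conv_hull X.
Proof. exact: sub_smallest. Qed.

Lemma conv_hull_min A X : convex_set A -> X `<=` A -> conv_hull X `<=` A.
Proof. exact: smallest_sub. Qed.

Lemma convex_halfspace c a : convex_set [set x | dot c x <= a].
Proof.
apply/convex_setP => x y t /andP[t0 t1] /= xa ya.
by rewrite dotDr !dotZr; nra.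
Qed.

Lemma segment_sub A x y : convex_set A -> A x -> A y -> segment x y `<=` A.
Proof.
move=> /convex_setP cA Ax Ay _ [t /andP[t0 t1] ->]; rewrite addrC.
by apply: cA; rewrite ?t0.
Qed.

Lemma segmentC x y : segment x y = segment y x.
Proof.
by apply/seteqP; split=> _ [t t01 ->]; exists (1 - t);
  rewrite ?subKr 1?addrC//; lra.
Qed.

Lemma segmentL x y : segment x y x.
Proof. by exists 0; rewrite ?lexx ?ler01// subr0 scale1r scale0r addr0. Qed.

Lemma segmentxx x : segment x x = [set x].
Proof.
apply/seteqP; split=> [_ [t _ ->]|_ ->]; last exact: segmentL.
by rewrite /= -scalerDl subrK scale1r.
Qed.

Lemma antipodalC A x y : antipodal A x y -> antipodal A y x.
Proof.
move=> [Ax Ay [c [a [b [c0 cx cy cA]]]]]; split=> //.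
exists (- c), (- b), (- a); rewrite oppr_eq0 !dotNl cx cy; split=> // z Az.
by rewrite dotNl !lerN2 andbC cA.
Qed.

Section FiniteHull.
Variables (T : finType) (pt : T -> 'rV[R]_d).
Local Notation P := (conv_hull (range pt)).

Lemma conv_hull_pt g : P (pt g).
Proof. by apply: sub_conv_hull; exists g. Qed.

Lemma conv_hull_range z : P z -> exists w : T -> R,
  [/\ forall g, 0 <= w g, \sum_g w g = 1 & z = \sum_g w g *: pt g].
Proof.
apply: (@conv_hull_min [set z | exists w : T -> R,
  [/\ forall g, 0 <= w g, \sum_g w g = 1 & z = \sum_g w g *: pt g]]).
  apply/convex_setP => x y t /andP[t0 t1] [u [u0 u1 ->]] [v [v0 v1 ->]].
  exists (fun g => t * u g + (1 - t) * v g); split.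
  + by move=> g; rewrite addr_ge0// mulr_ge0// subr_ge0.
  + by rewrite big_split/= -!mulr_sumr u1 v1 !mulr1 addrC subrK.
  + rewrite !scaler_sumr -big_split/=; apply: eq_bigr => g _.
    by rewrite [RHS]scalerDl !scalerA.
move=> _ [g _ <-]; exists (fun k => (k == g)%:R); split.
- by move=> k; rewrite ler0n.
- by rewrite (bigD1 g)//= eqxx big1 ?addr0// => k /negPf ->.
- rewrite (bigD1 g)//= eqxx scale1r big1 ?addr0// => k /negPf ->.
  by rewrite scale0r.
Qed.

Lemma conv_hull_le c a : (forall g, dot c (pt g) <= a) ->
  forall z, P z -> dot c z <= a.
Proof.
move=> ca; apply: conv_hull_min (@convex_halfspace c a) _.
by move=> _ [g _ <-]; apply: ca.
Qed.

Lemma conv_hull_ge c a : (forall g, a <= dot c (pt g)) ->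
  forall z, P z -> a <= dot c z.
Proof.
move=> ca z Pz; rewrite -lerN2 -dotNl; apply: conv_hull_le Pz => g.
by rewrite dotNl lerN2.
Qed.

(** The terms [w g * (a - dot c (pt g))] are nonnegative and sum to zero. *)
Lemma max_weight c a (w : T -> R) :
    (forall g, dot c (pt g) <= a) -> (forall g, 0 <= w g) ->
    \sum_g w g = 1 -> dot c (\sum_g w g *: pt g) = a ->
  forall g, w g != 0 -> dot c (pt g) = a.
Proof.
move=> ca w0 w1 cwa g wg.
have : \sum_g w g * (a - dot c (pt g)) = 0.
  under eq_bigr do rewrite mulrBr; rewrite sumrB -mulr_suml w1 mul1r.
  apply/eqP; rewrite subr_eq0 -{1}cwa dot_sum; apply/eqP/eq_bigr => k _.
  by rewrite dotZr.
move/psumr_eq0P => /(_ _ g isT) wc.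
have /eqP : w g * (a - dot c (pt g)) = 0.
  by apply: wc => k _; rewrite mulr_ge0// subr_ge0.
by rewrite mulf_eq0 (negPf wg) subr_eq0 => /eqP.
Qed.

(* With [g1 = g2] this says that [pt g1] is a vertex. *)
Lemma face_segment c a g1 g2 :
    (forall g, dot c (pt g) <= a) ->
    (forall g, dot c (pt g) = a <-> g = g1 \/ g = g2) ->
  face P (segment (pt g1) (pt g2)).
Proof.
move=> ca cE.
have cg1 : dot c (pt g1) = a by apply/cE; left.
have cg2 : dot c (pt g2) = a by apply/cE; right.
split; first by exists (pt g1); apply: segmentL.
exists c, a; split; first exact: conv_hull_le.
apply/seteqP; split=> [z zs|z /= [/conv_hull_range[w [w0 w1 ->]] ws]].
  split; first by apply: segment_sub zs;
    [exact: convex_conv_hull|exact: conv_hull_pt..].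
  by case: zs => t _ ->; rewrite /= dotDr !dotZr cg1 cg2; ring.
have wE := max_weight ca w0 w1 ws.
(* Taking all the weight off [g1], rather than [w g2], also covers [g1 = g2]. *)
exists (\sum_(g | g != g1) w g).
  rewrite sumr_ge0//= -w1 [leRHS](bigID (fun g => g == g1))/= lerDr.
  by rewrite sumr_ge0.
have -> : 1 - \sum_(g | g != g1) w g = w g1.
  by rewrite -w1 (bigD1 g1)//= addrK.
rewrite (bigD1 g1)//= scaler_suml; congr (_ + _); apply: eq_bigr => g gg1.
have [->|/wE/cE[gg|->//]] := eqVneq (w g) 0; first by rewrite !scale0r.
by rewrite gg eqxx in gg1.
Qed.

(** Points with nonzero weight in a convex combination giving [x] lie on the face, so they are
    [x + t *: (y - x)] with [t >= 0]. Their weighted offsets cancel, so each of them equals [x]. *)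
Lemma face_segment_end x y : face P (segment x y) -> exists g, x = pt g.
Proof.
move=> [_ [c [a [ca sE]]]].
have : segment x y x by exact: segmentL.
rewrite {1}sE => -[/conv_hull_range[w [w0 w1 xw]] /= cxa].
have wE g : w g != 0 -> segment x y (pt g).
  move=> wg; rewrite sE; split; first exact: conv_hull_pt.
  apply: (max_weight _ w0 w1 _ wg); last by rewrite -xw.
  by move=> k; apply: ca; apply: conv_hull_pt.
have [g wg] : exists g, w g != 0.
  apply: contrapT => /forallNP w_eq0; move: w1; rewrite big1.
    by move/eqP; rewrite eq_sym oner_eq0.
  by move=> g _; apply/eqP/negPn/negP/w_eq0.
have /choice[t tP] k : exists t, 0 <= t /\ (w k != 0 -> pt k = x + t *: (y - x)).
  have [wk|wk] := eqVneq (w k) 0; first by exists 0.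
  have [t /andP[t0 _] ->] := wE k wk; exists t; split=> // _.
  by rewrite scalerBl scale1r scalerBr -addrA [- _ + _]addrC.
exists g; have [_ ->//] := tP g.
have /eqP : (\sum_k w k * t k) *: (y - x) = 0.
  apply: (addrI x); rewrite addr0 {3}xw scaler_suml.
  rewrite -{1}[x]scale1r -w1 scaler_suml -big_split/=; apply: eq_bigr => k _.
  have [->|wk] := eqVneq (w k) 0; first by rewrite mul0r !scale0r addr0.
  by rewrite (tP k).2// [RHS]scalerDr scalerA.
rewrite scaler_eq0 => /orP[/eqP/psumr_eq0P|/eqP->]; last by rewrite scaler0 addr0.
move=> /(_ (fun k _ => mulr_ge0 (w0 k) (tP k).1) g isT)/eqP.
by rewrite mulf_eq0 (negPf wg) => /eqP ->; rewrite scale0r addr0.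
Qed.

Lemma antipodal_ptP g1 g2 : antipodal P (pt g1) (pt g2) <->
  exists2 c, c != 0 &
    forall g, dot c (pt g1) <= dot c (pt g) <= dot c (pt g2).
Proof.
split=> [[_ _ [c [_ [_ [c0 <- <- cP]]]]]|[c c0 cP]].
  by exists c => // g; apply: cP; apply: conv_hull_pt.
split; [exact: conv_hull_pt..|exists c, (dot c (pt g1)), (dot c (pt g2))].
split=> // z Pz; apply/andP; split.
- by apply: conv_hull_ge Pz => g; case/andP: (cP g).
- by apply: conv_hull_le Pz => g; case/andP: (cP g).
Qed.

Lemma midpoint_min_segment c x y z :
    segment x y z -> dot c (midpoint x y) <= dot c x ->
    dot c (midpoint x y) <= dot c y ->
  dot c z = dot c (midpoint x y).
Proof.
move=> [t _ ->]; rewrite dot_midpoint dotDr !dotZr => cx cy.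
have -> : dot c y = dot c x by lra.
by field.
Qed.

(** A functional extremal at the midpoint of a segment inside [P] is constant on the segment.
    Constancy is proved on the segment as a set, so the ends in the definition need not be matched
    with the given ones. *)
Lemma antipodal_midpointsP g1 g2 h1 h2 :
  antipodal_midpoints P (segment (pt g1) (pt g2)) (segment (pt h1) (pt h2)) <->
  exists2 c, c != 0 &
    [/\ dot c (pt g1) = dot c (pt g2), dot c (pt h1) = dot c (pt h2) &
      forall g, dot c (pt g1) <= dot c (pt g) <= dot c (pt h1)].
Proof.
split=> [[x [y [x' [y' [gE hE [_ _ [c [a [b [c0 xya xyb cP]]]]]]]]]]|].
  have gP z : segment (pt g1) (pt g2) z -> P z.
    by apply: segment_sub; [exact: convex_conv_hull|exact: conv_hull_pt..].
  have hP z : segment (pt h1) (pt h2) z -> P z.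
    by apply: segment_sub; [exact: convex_conv_hull|exact: conv_hull_pt..].
  have ga z : segment (pt g1) (pt g2) z -> dot c z = a.
    rewrite gE -xya => zs.
    apply: (midpoint_min_segment zs); rewrite xya.
    + have : P x by apply: gP; rewrite gE; exact: segmentL.
      by move=> /cP/andP[].
    + have : P y by apply: gP; rewrite gE segmentC; exact: segmentL.
      by move=> /cP/andP[].
  have hb z : segment (pt h1) (pt h2) z -> dot c z = b.
    rewrite hE -xyb => zs; apply/oppr_inj; rewrite -!dotNl.
    apply: (midpoint_min_segment zs); rewrite !dotNl lerN2 xyb.
    + have : P x' by apply: hP; rewrite hE; exact: segmentL.
      by move=> /cP/andP[].
    + have : P y' by apply: hP; rewrite hE segmentC; exact: segmentL.
      by move=> /cP/andP[].
  have g1E := ga _ (segmentL _ _); have h1E := hb _ (segmentL _ _).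
  move: ga hb; rewrite segmentC (segmentC (pt h1)) => ga hb.
  exists c => //; rewrite g1E h1E (ga _ (segmentL _ _)) (hb _ (segmentL _ _)).
  by split=> // g; apply: cP; apply: conv_hull_pt.
move=> [c c0 [g12 h12 cP]].
exists (pt g1), (pt g2), (pt h1), (pt h2); split=> //.
have mid_in g h : P (midpoint (pt g) (pt h)).
  apply: (@segment_sub _ (pt g) (pt h)); last 1 first.
  - exists (2^-1); first lra.
    by rewrite /midpoint scalerDr; congr (_ *: _ + _); field.
  - exact: convex_conv_hull.
  - exact: conv_hull_pt.
  - exact: conv_hull_pt.
split=> //; exists c, (dot c (pt g1)), (dot c (pt h1)); split=> //.
- by rewrite dot_midpoint -g12; field.
- by rewrite dot_midpoint -h12; field.
- move=> z Pz; apply/andP; split.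
  + by apply: conv_hull_ge Pz => g; case/andP: (cP g).
  + by apply: conv_hull_le Pz => g; case/andP: (cP g).
Qed.

End FiniteHull.
End ConvHull.

(** * Counting unordered pairs *)

Section PairCount.

(** The image is exhibited as a finite set, so [fset_set] does not fall back to the empty set. *)
Lemma card_fset_set_image (T : finType) (U : choiceType) (f : T -> U)
    (D : {set T}) :
  {in D &, injective f} -> #|` fset_set (f @` [set` D])| = #|D|.
Proof.
move=> f_inj.
have -> : f @` [set` D] = [set` [fset f x | x in D]%fset].
  apply/seteqP; split=> [_ [x xD <-]|y /= /imfsetP[x xD ->]]; last by exists x.
  by apply/imfsetP; exists x.
by rewrite set_fsetK card_in_imfset//= cardE.
Qed.

(** The injective [rank] selects one of the two orders of each pair of distinct elements. *)
Lemma sum_sym_rel (T : finType) (rank : T -> nat) (r : rel T) :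
    injective rank -> symmetric r ->
  (\sum_x \sum_y ((x != y) && r x y))%N =
  (2 * #|[set p : T * T | (rank p.1 < rank p.2)%N && r p.1 p.2]%SET|)%N.
Proof.
move=> rank_inj r_sym.
pose lt x y : nat := (rank x < rank y)%N && r x y.
have -> : #|[set p : T * T | (rank p.1 < rank p.2)%N && r p.1 p.2]%SET| =
    (\sum_x \sum_y lt x y)%N.
  by rewrite pair_bigA -sum1_card big_mkcond; apply: eq_bigr => p _; rewrite inE.
rewrite mul2n -addnn.
rewrite [X in _ = (_ + X)%N]exchange_big -big_split; apply: eq_bigr => x _ /=.
rewrite -big_split; apply: eq_bigr => y _ /=.
rewrite /lt (r_sym y); case: (r x y); rewrite ?andbF// !andbT.
by rewrite -(inj_eq rank_inj); case: ltngtP.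
Qed.

Lemma card_doubletons (T : finType) (U : Type) (f : T -> U) (r : rel T) :
    injective f -> symmetric r ->
  (2 * #|` fset_set [set S : set U | exists x y,
             [/\ x != y, r x y & S = [set f x; f y]]]|)%N =
  (\sum_x \sum_y ((x != y) && r x y))%N.
Proof.
move=> f_inj r_sym.
pose rank (x : T) : nat := enum_rank x.
have rank_inj : injective rank by move=> x y /val_inj/enum_rank_inj.
rewrite (sum_sym_rel rank_inj r_sym) -(@card_fset_set_image _ _
  (fun p => [set f p.1; f p.2])).
  congr (_ * #|` fset_set _|)%N; apply/seteqP; split=> [_ [x [y [xy rxy ->]]]|].
    have [lt_xy|lt_yx|/rank_inj/eqP] := ltngtP (rank x) (rank y).
    - by exists (x, y) => //=; rewrite inE lt_xy.
    - by exists (y, x); rewrite /= ?inE ?lt_yx 1?r_sym// setUC.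
    - by rewrite (negPf xy).
  move=> _ [[x y] /= + <-]; rewrite inE => /andP[/= lt_xy rxy].
  exists x, y; split=> //; apply: contraTneq lt_xy => ->; by rewrite ltnn.
(* Equal doubletons give the same pair: a swap would reverse the order of the ranks. *)
move=> [x y] [x' y']; rewrite !inE /= => /andP[xy _] /andP[xy' _] E.
have : [set f x; f y] (f x') by rewrite E; left.
have : [set f x; f y] (f y') by rewrite E; right.
move=> [] /f_inj ye [] /f_inj xe; move: xy'; rewrite ye xe ?ltnn//.
by move=> /(ltn_trans xy); rewrite ltnn.
Qed.

Lemma sum_option (T : finType) (F : option T -> nat) :
  (\sum_g F g = F None + \sum_i F (Some i))%N.
Proof.
rewrite (bigD1 None)//=; congr addn.
rewrite (reindex_omap Some id)/=; last by case.
by apply: eq_bigl => i; rewrite eqxx.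
Qed.

End PairCount.

(** * Pyramids *)

Section PyramidHeights.
Variables (R : realType) (n : nat) (q : 'I_n -> 'rV[R]_2).
Variables (o : 'rV[R]_3) (M : 'M[R]_(2, 3)) (apex : 'rV[R]_3).
Hypotheses (hM : row_free M) (hapex : ~ range (place o M) apex).
Hypothesis q_inj : injective q.

Definition pyramid_vertex (g : option 'I_n) : 'rV[R]_3 :=
  if g is Some i then place o M (q i) else apex.
Local Notation pt := pyramid_vertex.
Local Notation P := (conv_hull (range pt)).

Lemma place_conv x y t :
  place o M (t *: x + (1 - t) *: y) =
  t *: place o M x + (1 - t) *: place o M y.
Proof.
rewrite /place mulmxDl -!scalemxAl [in RHS]scalerDr [X in _ = _ + X]scalerDr.
by rewrite addrACA -scalerDl [t + _]addrC subrK scale1r.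
Qed.

(** The preimage of [P] under the affine map [place o M] is convex and contains the [q i], hence
    contains the whole polygon. *)
Lemma pyramidE : pyramid q o M apex = P.
Proof.
apply/seteqP; split; apply: conv_hull_min; try exact: convex_conv_hull.
  move=> _ [[x qx <-]|->]; last exact: (@conv_hull_pt _ _ _ pt None).
  suff /(_ x qx) : polygon_region q `<=` [set x | P (place o M x)] by [].
  apply: conv_hull_min => [|_ [i _ <-]]; last first.
    exact: (@conv_hull_pt _ _ _ pt (Some i)).
  apply/convex_setP => y z t t01 Py Pz; rewrite /mkset place_conv.
  by apply: (convex_setP P).1 => //; exact: convex_conv_hull.
move=> _ [[i|] _ <-]; apply: sub_conv_hull; last by right.
by left; exists (q i) => //; apply: sub_conv_hull; exists i.
Qed.

Lemma pyramid_vertex_inj : injective pt.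
Proof.
have place_inj : injective (place o M).
  by move=> x y /addrI; apply: row_free_inj.
move=> [i|] [j|] //= => [/place_inj/q_inj->//|E|E].
- by case: hapex; exists (q i).
- by case: hapex; exists (q j).
Qed.

Variable s : R.
Hypothesis s0 : s != 0.

(* The affine functionals on space, up to a constant: [d] determines the
   restriction to the base plane and [h] is the value at the apex. *)
Definition height d h (g : option 'I_n) : R :=
  if g is Some i then s * cross d (q i) else h.

Lemma row_mulmx2 (x : 'rV[R]_2) (w : 'cV[R]_2) :
  (x *m w) 0 0 = x 0 0 * w 0 0 + x 0 1 * w 1 0.
Proof.
rewrite mxE big_ord_recl big_ord1.
by congr (_ * _ + x 0 _ * w _ 0); apply: val_inj.
Qed.

Let frame : 'M[R]_3 := col_mx M (apex - o).

(** A relation between the rows of [M] and [apex - o] with nonzero last coefficient would put the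
    apex in the base plane; otherwise [hM] applies. *)
Lemma frame_unit : frame \in unitmx.
Proof.
rewrite -row_free_unit; apply: inj_row_free => v.
have [a [b ->]] : exists (a : 'rV_2) (b : 'rV_1), v = row_mx a b.
  by exists (@lsubmx _ 1 2 1 v), (@rsubmx _ 1 2 1 v); rewrite hsubmxK.
have -> : row_mx a b *m frame = a *m M + b *m (apex - o) by exact: mul_row_col.
rewrite [b]mx11_scalar mul_scalar_mx.
have [->|b0] := eqVneq (b 0 0) 0.
  rewrite scale0r addr0 => /eqP aM.
  have -> : a = 0 by apply: (row_free_inj hM); rewrite mul0mx (eqP aM).
  by rewrite (_ : 0%:M = 0) ?row_mx0//; apply: raddf0.
move=> /(congr1 (fun u => (b 0 0)^-1 *: u)); rewrite scalerDr scalerA mulVf//.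
rewrite scale1r scaler0 => E; case: hapex; exists (- ((b 0 0)^-1 *: a)) => //.
rewrite /place mulNmx -scalemxAl; apply/eqP; rewrite eq_sym -subr_eq0 opprD opprK.
by rewrite addrA addrC E.
Qed.

Lemma frame_mul (v : 'cV[R]_3) :
  frame *m v = col_mx (M *m v) ((apex - o) *m v).
Proof. exact: (mul_col_mx M (apex - o) v). Qed.

Lemma dot_place c x : dot c (place o M x) = dot c o + (x *m (M *m c^T)) 0 0.
Proof. by rewrite dotDr [in X in _ + X]dotE mulmxA. Qed.

Lemma dot_height c : exists d h, (d = 0 -> h = 0 -> c = 0) /\
  forall g, dot c (pt g) = dot c o + height d h g.
Proof.
pose w := M *m c^T.
(* The solution [d] of [s * cross d x = (x *m w) 0 0] for all [x]. *)
exists (\row_(j < 2) if j == 0 then w 1 0 / s else - (w 0 0 / s)).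
exists (dot c apex - dot c o); split=> [d0 h0|[i|]]; last 1 first.
- by rewrite /= addrC subrK.
- have w0 : w = 0.
    apply/colP => j; rewrite [RHS]mxE.
    have := congr1 (fun d : 'rV_2 => d 0 0) d0.
    have := congr1 (fun d : 'rV_2 => d 0 1) d0.
    rewrite !mxE /= => /eqP; rewrite oppr_eq0 mulf_eq0 invr_eq0 (negPf s0) orbF.
    move=> /eqP w0 /eqP; rewrite mulf_eq0 invr_eq0 (negPf s0) orbF => /eqP w1.
    case: j => -[|[|//]] j2.
    + by rewrite (_ : Ordinal j2 = 0)//; apply: val_inj.
    + by rewrite (_ : Ordinal j2 = 1)//; apply: val_inj.
  have : frame *m c^T = 0.
    rewrite frame_mul -/w w0 (_ : _ *m c^T = 0) ?col_mx0//.
    apply/matrixP => a b; rewrite !ord1 [RHS]mxE -dotE -[RHS]h0.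
    by rewrite dotDr -scaleN1r dotZr mulN1r.
  move=> /(congr1 (mulmx (invmx frame))); rewrite mulKmx ?frame_unit// mulmx0.
  by move=> /(congr1 trmx); rewrite trmxK trmx0.
- rewrite /= dot_place row_mulmx2 /cross !mxE /=; congr (_ + _).
  by rewrite -/w; field.
Qed.

(** Since [frame] is invertible, the functional on the base directions and the value on [apex - o]
    can be prescribed independently. *)
Lemma height_dot d h : exists c,
  forall g, dot c (pt g) = dot c o + height d h g.
Proof.
pose w : 'cV[R]_2 := \col_j (if j == 0 then - (s * d 0 1) else s * d 0 0).
pose c := (invmx frame *m col_mx w h%:M)^T.
have : frame *m c^T = col_mx w h%:M by rewrite trmxK mulKVmx ?frame_unit.
rewrite frame_mul => /(@eq_col_mx _ 2 1 1)[Mc ac]; exists c => -[i|] /=.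
  rewrite dot_place Mc row_mulmx2 !mxE /= /cross; congr (_ + _); ring.
have := congr1 (fun u : 'M_1 => u 0 0) ac; rewrite -dotE dotDr -scaleN1r dotZr.
by rewrite mulN1r [_%:M _ _]mxE eqxx mulr1n => <-; rewrite addrC subrK.
Qed.

End PyramidHeights.

(** * Vertices and edges of the pyramid *)

Section PyramidFaces.
Variables (R : realType) (n : nat) (q : 'I_n -> 'rV[R]_2).
Variables (o : 'rV[R]_3) (M : 'M[R]_(2, 3)) (apex : 'rV[R]_3) (s : R).
Hypotheses (hM : row_free M) (hapex : ~ range (place o M) apex).
Hypotheses (q_inj : injective q) (q_adj : no_adjacent_collinear q).
Hypothesis s0 : s != 0.
Hypothesis q_left : forall i k, 0 <= s * cross (edge_vector q i) (q k - q i).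
Variable i0 : 'I_n.

Local Notation e := (edge_vector q).
Local Notation pt := (pyramid_vertex q o M apex).
Local Notation P := (conv_hull (range pt)).
Local Notation ht := (height q s).

Lemma cross_edges_eq0 d : (forall i, cross d (e i) = 0) -> d = 0.
Proof.
move=> de; apply/eqP; apply: contraT => d0.
have [a ea] := cross_eq0P d0 (de i0).
have [b eb] := cross_eq0P d0 (de (ordS i0)).
have := q_adj i0; rewrite /parallel_edges ea eb crossZl crossZr crossvv.
by rewrite !mulr0 eqxx.
Qed.

Lemma height_cst d h : (forall g, ht d h g = ht d h None) -> d = 0 /\ h = 0.
Proof.
move=> cst; have d0 : d = 0.
  apply: cross_edges_eq0 => i; rewrite crossBr; apply: (mulfI s0).
  by rewrite mulr0 mulrBr; apply/eqP; rewrite subr_eq0; apply/eqP;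
    rewrite -!/(ht d h (Some _)) !cst.
split=> //; have := cst (Some i0); rewrite /= d0 => <-.
by rewrite cross0l mulr0.
Qed.

(** If the two levels agreed, the height would be constant on all vertices, forcing [d], [h] and
    then [c] to vanish. The strict inequality thus takes over the role of [c != 0]. *)
Lemma strip_height c g1 g2 : c != 0 ->
    (forall g, dot c (pt g1) <= dot c (pt g) <= dot c (pt g2)) ->
  exists d h, ht d h g1 < ht d h g2 /\
    forall g, dot c (pt g) = dot c o + ht d h g.
Proof.
move=> c0 cP; have [d [h [c_eq0 cE]]] := dot_height q hM hapex s0 c.
exists d, h; split=> //.
have hP g : ht d h g1 <= ht d h g <= ht d h g2.
  by have := cP g; rewrite !cE !lerD2l.
have /andP[h1 h2] := hP g1; rewrite lt_neqAle h2 andbT.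
apply: contra_neq c0 => h12.
have [|d0 h0] := @height_cst d h; last exact: c_eq0.
have cst g : ht d h g = ht d h g1.
  by apply/eqP; rewrite eq_le andbC {2}h12; exact: hP.
by move=> g; rewrite !cst.
Qed.

Lemma height_strip d h g1 g2 : ht d h g1 < ht d h g2 ->
  exists2 c, c != 0 & forall g, dot c (pt g) = dot c o + ht d h g.
Proof.
move=> lt12; have [c cE] := height_dot q hM hapex s d h; exists c => //.
apply: contraTneq lt12 => c0; rewrite -(ltrD2l (dot c o)) -!cE c0.
by rewrite !dotE trmx0 !mulmx0 ltxx.
Qed.

Lemma antipodal_vertex_height g1 g2 : antipodal P (pt g1) (pt g2) <->
  exists d h, ht d h g1 < ht d h g2 /\
    forall g, ht d h g1 <= ht d h g <= ht d h g2.
Proof.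
rewrite antipodal_ptP; split=> [[c c0 cP]|[d [h [lt12 hP]]]].
  have [d [h [lt12 cE]]] := strip_height c0 cP; exists d, h; split=> // g.
  by have := cP g; rewrite !cE !lerD2l.
have [c c0 cE] := height_strip lt12; exists c => // g.
by rewrite !cE !lerD2l.
Qed.

Lemma antipodal_midpoints_height g1 g2 h1 h2 :
  antipodal_midpoints P (segment (pt g1) (pt g2)) (segment (pt h1) (pt h2)) <->
  exists d h, [/\ ht d h g1 = ht d h g2, ht d h h1 = ht d h h2,
      ht d h g1 < ht d h h1 &
      forall g, ht d h g1 <= ht d h g <= ht d h h1].
Proof.
rewrite antipodal_midpointsP.
split=> [[c c0 [c12 c12' cP]]|[d [h [h12 h12' lt hP]]]].
  have [d [h [lt cE]]] := strip_height c0 cP; exists d, h.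
  move: c12 c12'; rewrite !cE => /addrI h12 /addrI h12'; split=> // g.
  by have := cP g; rewrite !cE !lerD2l.
have [c c0 cE] := height_strip lt; exists c => //.
by rewrite !cE h12 h12'; split=> // g; rewrite !cE !lerD2l -h12 -h12'.
Qed.

Lemma face_height d h g1 g2 :
    (forall g, ht d h g <= ht d h g1) ->
    (forall g, ht d h g = ht d h g1 <-> g = g1 \/ g = g2) ->
  face P (segment (pt g1) (pt g2)).
Proof.
move=> h1 hE; have [c cE] := height_dot q hM hapex s d h.
apply: (@face_segment _ _ _ pt c (dot c (pt g1))) => g; first by rewrite !cE lerD2l.
by rewrite !cE -hE; split=> [/addrI|->].
Qed.

(** The functionals of the two edges at [q i] are both minimal there, and [q i] is the only vertex
    on both edge lines; the negated sum is therefore strictly maximal at [q i]. *)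
Lemma vertex_direction i :
  exists d, forall k, k != i -> s * cross d (q k) < s * cross d (q i).
Proof.
exists (- (e (ord_pred i) + e i)) => k ki.
rewrite -subr_lt0 -mulrBr -crossBr crossNl crossDl mulrN oppr_lt0 mulrDr.
have pE : cross (e (ord_pred i)) (q k - q i) =
    cross (e (ord_pred i)) (q k - q (ord_pred i)).
  have -> : q k - q i = q k - q (ord_pred i) - e (ord_pred i).
    by rewrite /edge_vector ord_predK opprB addrA subrK.
  by rewrite (crossBr _ (q k - _)) crossvv subr0.
rewrite lt_def pE addr_ge0// andbT; apply: contraNneq ki => /eqP.
rewrite paddr_eq0// => /andP[/eqP/(q_left_eq0 q_inj s0 q_adj q_left) kp].
move=> /eqP/(q_left_eq0 q_inj s0 q_adj q_left)[->//|kS].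
move: kp; rewrite ord_predK => -[kp|->//].
have := ordSS_neq q_adj (ord_pred i).
by rewrite ord_predK -kS kp eqxx.
Qed.

Lemma height_strict_max g : exists d h,
  forall k, k != g -> ht d h k < ht d h g.
Proof.
case: g => [i|].
  have [d dP] := vertex_direction i; exists d, (s * cross d (q i) - 1).
  by move=> [k ki|_] /=; [apply: dP|rewrite ltrBlDr ltrDl].
exists 0, 1 => -[k _|//] /=.
by rewrite cross0l mulr0.
Qed.

Lemma vertex_pyramid : [set x | vertex P x] = range pt.
Proof.
apply/seteqP; split=> [x|_ [g _ <-]].
  by rewrite /vertex /= -segmentxx => /face_segment_end[g ->]; exists g.
rewrite /vertex /= -segmentxx; have [d [h lt_g]] := height_strict_max g.
apply: (@face_height d h) => k; have [->|/lt_g ltk] := eqVneq k g.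
- by [].
- exact: ltW.
- by split=> // _; left.
- split=> [kg|[] kg]; first by rewrite kg ltxx in ltk.
  all: by rewrite kg ltxx in ltk.
Qed.

(** A functional with strict maximum at [pt g] exceeds its values on any segment between two other
    vertices. This recovers the indices from a segment. *)
Lemma pyramid_vertex_segment g1 g2 g :
  segment (pt g1) (pt g2) (pt g) <-> g = g1 \/ g = g2.
Proof.
split=> [[t /andP[t0 t1]]|[]->]; last 2 first.
- exact: segmentL.
- by rewrite segmentC; exact: segmentL.
have [d [h lt_g]] := height_strict_max g.
have [c cE] := height_dot q hM hapex s d h.
move=> /(congr1 (dot c)); rewrite dotDr !dotZr !cE => gE.
have [->|/lt_g lt1] := eqVneq g1 g; first by left.
have [->|/lt_g lt2] := eqVneq g2 g; first by right.
exfalso; move: gE lt1 lt2; move: (ht d h g) (ht d h g1) (ht d h g2) => z x y gE xz yz.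
have [t_lt1|t_ge1] := ltP t 1.
  have : 0 < (1 - t) * (z - x) by rewrite mulr_gt0// subr_gt0.
  have : 0 <= t * (z - y) by rewrite mulr_ge0// subr_ge0 ltW.
  by lra.
have t_eq1 : t = 1 by apply: le_anti; rewrite t1.
by move: gE; rewrite t_eq1; lra.
Qed.

Definition edge_ends (b : 'I_n + 'I_n) : option 'I_n * option 'I_n :=
  match b with
  | inl i => (Some i, Some (ordS i))
  | inr i => (Some i, None)
  end.

Definition edge_segment b :=
  segment (pt (edge_ends b).1) (pt (edge_ends b).2).

(** Equal segments contain the same vertices. Two base edges with exchanged ends are excluded by
    [ordSS_neq]. *)
Lemma edge_segment_inj : injective edge_segment.
Proof.
move=> b b' bb'.
have bE g : (g = (edge_ends b).1 \/ g = (edge_ends b).2) <->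
    (g = (edge_ends b').1 \/ g = (edge_ends b').2).
  by rewrite -!pyramid_vertex_segment -!/(edge_segment _) bb'.
have Sn := ordS_neq q_adj; have SSn := ordSS_neq q_adj.
case: b b' bE {bb'} => [i|i] [j|j] /= bE.
- have [->//|iSj] : i = j \/ i = ordS j.
    by case: ((bE (Some i)).1 (or_introl erefl)) => /Some_inj; [left|right].
  have [Sij|/ordS_inj->//] : ordS i = j \/ ordS i = ordS j.
    by case: ((bE (Some (ordS i))).1 (or_intror erefl)) => /Some_inj; [left|right].
  by have := SSn j; rewrite -iSj Sij eqxx.
- by case: ((bE None).2 (or_intror erefl)).
- by case: ((bE None).1 (or_intror erefl)).
- by case: ((bE (Some i)).1 (or_introl erefl)) => // /Some_inj->.
Qed.

Lemma edge_pyramid : [set F | edge P F] = range edge_segment.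
Proof.
apply/seteqP; split=> [F [FP [x [y [xy FE]]]]|_ [b _ <-]]; last first.
  split; last first.
    exists (pt (edge_ends b).1), (pt (edge_ends b).2); split=> //.
    rewrite inj_eq; last exact: pyramid_vertex_inj.
    by case: b => i //=; rewrite -[_ == _]/(i == ordS i) eq_sym (ordS_neq q_adj).
  case: b => i.
    (* The supporting line of base edge [i] is extended to a plane with the apex one unit below the
       maximum. *)
    apply: (@face_height (- e i) (s * cross (- e i) (q i) - 1)).
      move=> [k|]; rewrite /= ?gerBl// -subr_le0 -mulrBr -crossBr crossNl.
      by rewrite mulrN oppr_le0.
    move=> [k|] /=; last first.
      by split=> [/eqP|[]//]; rewrite -subr_eq0 addrAC subrr sub0r oppr_eq0 oner_eq0.
    split=> [/eqP|[[->]//|[->]]].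
      rewrite -subr_eq0 -mulrBr -crossBr crossNl mulrN oppr_eq0.
      by move=> /eqP/(q_left_eq0 q_inj s0 q_adj q_left)[]->; [left|right].
    apply/eqP; rewrite -subr_eq0 -mulrBr -crossBr crossNl.
    by rewrite -/(edge_vector q i) crossvv oppr0 mulr0.
  (* For a lateral edge, the apex is lifted to the height of [q i], the strict maximum on the
     base. *)
  have [d dP] := vertex_direction i.
  apply: (@face_height d (s * cross d (q i))) => -[k|] //=.
  - by have [->//|/dP/ltW] := eqVneq k i.
  - split=> [|[[->]|]//]; have [->|/dP + kE] := eqVneq k i; first by left.
    by rewrite kE ltxx.
  - by split=> // _; right.
rewrite FE in FP *; have [g1 xE] := face_segment_end FP.
have [g2 yE] : exists g, y = pt g.
  by apply: (@face_segment_end _ _ _ _ y x); rewrite segmentC.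
rewrite {}xE {}yE in FP xy *; have {xy}g12 : g1 != g2.
  by apply: contraNneq xy => ->.
case: g1 g2 FP g12 => [i|] [j|] // FP g12; last 2 first.
- by exists (inr i).
- by exists (inr j) => //; exact: segmentC.
have ij : i != j by apply: contraNneq g12 => ->.
have [_ [c [a [cP FE']]]] := FP.
have [d [h [_ cE]]] := dot_height q hM hapex s0 c.
have inF g : dot c (pt g) = a -> g = Some i \/ g = Some j.
  move=> ga; rewrite -pyramid_vertex_segment FE'; split=> //.
  exact: conv_hull_pt.
have Fin g : g = Some i \/ g = Some j -> dot c (pt g) = a.
  by rewrite -pyramid_vertex_segment FE' => -[].
have ai := Fin _ (or_introl erefl); have aj := Fin _ (or_intror erefl).
have hij : ht d h (Some i) = ht d h (Some j).
  by apply: (addrI (dot c o)); rewrite -!cE ai aj.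
have hle k : ht d h (Some k) <= ht d h (Some i).
  by rewrite -(lerD2l (dot c o)) -!cE ai; apply/cP; apply: conv_hull_pt.
(* If [d = 0], all base vertices lie on the face, hence are among two, although [i], [ordS i] and
   [ordS (ordS i)] are distinct. *)
have [d0|d0] := eqVneq d 0.
  have all_ij k : k = i \/ k = j.
    have [|[->]|[->]] := inF (Some k); [|by left|by right].
    rewrite -ai !cE /= d0; congr (_ + _ * _).
    by rewrite !cross0l.
  have Sj k : k = i \/ k = j -> k != i -> k = j by move=> [->|//]; rewrite eqxx.
  have Si := Sj _ (all_ij (ordS i)) (ordS_neq q_adj i).
  have SSi := Sj _ (all_ij (ordS (ordS i))) (ordSS_neq q_adj i).
  by have := ordS_neq q_adj (ordS i); rewrite SSi Si eqxx.
have [jS|iS] := support_adjacent q_inj s0 q_adj q_left d0 ij hij hle.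
  by exists (inl i) => //; rewrite jS.
by exists (inl j) => //; rewrite iS; exact: segmentC.
Qed.

(** * Antipodal vertices and antipodal edge midpoints *)

Definition vertices_antipodal (g1 g2 : option 'I_n) : bool :=
  match g1, g2 with
  | Some i, Some j => far q s i j || far q s j i
  (* A default value: [vertices_antipodalP] speaks of distinct indices. *)
  | None, None => false
  | _, _ => true
  end.

Definition edges_antipodal (b1 b2 : 'I_n + 'I_n) : bool :=
  match b1, b2 with
  | inl i, inl j => (i != j) && parallel_edges q i j
  | inl i, inr j | inr j, inl i => far q s i j
  | inr _, inr _ => false
  end.

Lemma vertices_antipodalP g1 g2 : g1 != g2 ->
  antipodal P (pt g1) (pt g2) <-> vertices_antipodal g1 g2.
Proof.
have apexP i : antipodal P (pt (Some i)) (pt None).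
  apply/antipodal_vertex_height; exists 0, 1.
  have c0 k : s * cross 0 (q k) = 0.
    by rewrite cross0l mulr0.
  by split=> [|[k|]]; rewrite /= !c0 ?ltr01 ?lexx ?ler01.
case: g1 g2 => [i|] [j|] // ij.
- rewrite antipodal_vertex_height.
  split=> [[d [h [lt hP]]]|/(farP q_inj s0 q_adj q_left)[d [lt dP]]].
    apply/(farP q_inj s0 q_adj q_left); exists d; split=> // k.
    exact: (hP (Some k)).
  (* Giving the apex the height of [q i] keeps it inside the strip. *)
  exists d, (s * cross d (q i)); split=> // -[k|]; first exact: dP.
  by rewrite /= lexx ltW.
- by split=> // _; apply/antipodalC/apexP.
Qed.

Lemma antipodal_midpointsC A E F :
  antipodal_midpoints (d := 3) A E F -> antipodal_midpoints (R := R) A F E.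
Proof.
move=> [x [y [x' [y' [EE FE EF]]]]]; exists x', y', x, y; split=> //.
exact: antipodalC.
Qed.

Lemma height_edge d h i :
  ht d h (Some i) = ht d h (Some (ordS i)) <-> cross d (e i) = 0.
Proof.
rewrite crossBr /=; split=> [/(mulfI s0)->|/eqP]; first by rewrite subrr.
by rewrite subr_eq0 => /eqP->.
Qed.

(** Level edges are both parallel to [d]. Conversely, [d = e i] works with the apex at the height of
    edge [i]. *)
Lemma antipodal_base_base i j :
  antipodal_midpoints P (edge_segment (inl i)) (edge_segment (inl j)) <->
  (i != j) && parallel_edges q i j.
Proof.
rewrite antipodal_midpoints_height; split=> [|/andP[ij pij]].
  move=> [d [h [/height_edge di /height_edge dj lt _]]].
  have d0 : d != 0.
    apply: contraTneq lt => ->.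
    by rewrite /= !cross0l ltxx.
  apply/andP; split; first by apply: contraTneq lt => ->; rewrite ltxx.
  have [a ei] := cross_eq0P d0 di; have [b ej] := cross_eq0P d0 dj.
  by rewrite /parallel_edges ei ej crossZl crossZr crossvv !mulr0.
have fij := parallel_far q_inj s0 q_adj q_left ij pij.
exists (e i), (s * cross (e i) (q i)); split.
- by apply/height_edge; rewrite crossvv.
- by apply/height_edge/eqP.
- exact: (far_lt q_inj).
- by move=> [k|]; rewrite /= ?lexx (edge_le q_left)// (forallP fij).
Qed.

(** The level base edge makes [d] a multiple of [e i], positive because that edge is the lower one;
    the level lateral edge puts the apex at the height of [q j]. *)
Lemma antipodal_base_lateral i j :
  antipodal_midpoints P (edge_segment (inl i)) (edge_segment (inr j)) <->
  far q s i j.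
Proof.
rewrite antipodal_midpoints_height; split=> [|fij].
  move=> [d [h [/height_edge di /= dj lt hP]]].
  have [a da] : exists a, d = a *: e i.
    by apply: cross_eq0P; [exact: edge_vector_neq0|rewrite crossC di oppr0].
  have hE k : s * cross d (q k) = a * (s * cross (e i) (q k)).
    by rewrite da crossZl mulrCA.
  have a0 : 0 < a.
    move: lt; rewrite !hE => lt.
    have := edge_le q_left i j; rewrite le_eqVlt => /orP[/eqP ij|lt'].
      by rewrite ij ltxx in lt.
    by rewrite -(@pmulr_lgt0 _ (s * cross (e i) (q j) - s * cross (e i) (q i)))
      ?subr_gt0// mulrBr subr_gt0.
  apply/forallP => k; rewrite -(ler_pM2l a0) -!hE.
  by have /andP[] := hP (Some k).
exists (e i), (s * cross (e i) (q j)); split=> //.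
- by apply/height_edge; rewrite crossvv.
- exact: (far_lt q_inj).
- by move=> [k|]; rewrite /= ?lexx (edge_le q_left)// (forallP fij).
Qed.

(** Both edges contain the apex, so their levels cannot differ. *)
Lemma antipodal_lateral_lateral i j :
  ~ antipodal_midpoints P (edge_segment (inr i)) (edge_segment (inr j)).
Proof.
move=> /antipodal_midpoints_height[d [h [/= di dj]]].
by rewrite di dj ltxx.
Qed.

Lemma edges_antipodalP b1 b2 :
  antipodal_midpoints P (edge_segment b1) (edge_segment b2) <->
  edges_antipodal b1 b2.
Proof.
case: b1 b2 => [i|i] [j|j] /=.
- exact: antipodal_base_base.
- exact: antipodal_base_lateral.
- rewrite -antipodal_base_lateral.
  by split; exact: antipodal_midpointsC.
- by split=> // /antipodal_lateral_lateral.
Qed.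

(** * The three counts for the pyramid *)

Lemma num_vertices_pyramid : num_vertices P = n.+1.
Proof.
rewrite /num_vertices vertex_pyramid -(_ : [set` [set: option 'I_n]%SET] = setT).
  rewrite card_fset_set_image; first by rewrite cardsT card_option card_ord.
  by move=> g1 g2 _ _; apply: pyramid_vertex_inj.
by apply/seteqP; split=> // g _; rewrite /= inE.
Qed.

Lemma num_antipodal_vertices_pyramid :
  (2 * num_antipodal_vertices P =
   2 * n + \sum_i \sum_j ((i != j) && (far q s i j || far q s j i)))%N.
Proof.
have vsym : symmetric vertices_antipodal.
  by move=> [i|] [j|] //=; rewrite orbC.
have pt_inj := pyramid_vertex_inj hM hapex q_inj.
transitivity (\sum_g1 \sum_g2 ((g1 != g2) && vertices_antipodal g1 g2))%N.
  rewrite -(card_doubletons pt_inj vsym) /num_antipodal_vertices.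
  congr (_ * #|` fset_set _|)%N; apply/seteqP; split=> S.
    have vE x : vertex P x -> exists g, x = pt g.
      move=> Px; have : [set x | vertex P x] x by exact: Px.
      by rewrite vertex_pyramid => -[g _ <-]; exists g.
    move=> [_ [_ [/vE[g1 ->] /vE[g2 ->] g12 anti ->]]]; exists g1, g2.
    have {}g12 : g1 != g2 by apply/eqP => g12'; rewrite g12' in g12.
    by split=> //; apply/vertices_antipodalP.
  move=> [g1 [g2 [g12 anti ->]]]; exists (pt g1), (pt g2).
  have Pg g : vertex P (pt g).
    by have : [set x | vertex P x] (pt g) by rewrite vertex_pyramid; exists g.
  split=> //; first by move/pt_inj/eqP; rewrite (negPf g12).
  exact/vertices_antipodalP.
(* The apex pairs with each of the [n] base vertices in both orders, whence [2 * n]. *)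
rewrite !sum_option /=; under [X in (_ + X)%N]eq_bigr do rewrite sum_option /=.
rewrite big_split /= !sum_nat_const card_ord !muln1 !addnA.
by congr (_ + _)%N; rewrite mul2n addnn.
Qed.

Lemma num_antipodal_edges_pyramid :
  (2 * num_antipodal_edges P =
   \sum_i \sum_j ((i != j) && parallel_edges q i j) +
   2 * \sum_i \sum_j far q s i j)%N.
Proof.
have esym : symmetric edges_antipodal.
  by move=> [i|i] [j|j] //=; rewrite eq_sym parallel_edgesC.
transitivity (\sum_b1 \sum_b2 ((b1 != b2) && edges_antipodal b1 b2))%N.
  rewrite -(card_doubletons edge_segment_inj esym) /num_antipodal_edges.
  congr (_ * #|` fset_set _|)%N; apply/seteqP; split=> S.
    have eE F : edge P F -> exists b, F = edge_segment b.
      move=> PF; have : [set F | edge P F] F by exact: PF.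
      by rewrite edge_pyramid => -[b _ <-]; exists b.
    move=> [_ [_ [/eE[b1 ->] /eE[b2 ->] b12 anti ->]]]; exists b1, b2.
    have {}b12 : b1 != b2 by apply/eqP => b12'; rewrite b12' in b12.
    by split=> //; apply/edges_antipodalP.
  move=> [b1 [b2 [b12 anti ->]]]; exists (edge_segment b1), (edge_segment b2).
  have Pb b : edge P (edge_segment b).
    by have : [set F | edge P F] (edge_segment b) by rewrite edge_pyramid; exists b.
  split=> //; first by move/edge_segment_inj/eqP; rewrite (negPf b12).
  exact/edges_antipodalP.
rewrite !big_sumType /=; under eq_bigr do rewrite big_sumType /=.
under [X in (_ + X)%N]eq_bigr do rewrite big_sumType /=.
rewrite !big_split /=.
rewrite -addnA; congr (_ + _)%N.
  by apply: eq_bigr => i _; apply: eq_bigr => j _; rewrite andbA andbb.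
(* Pairs of a base and a lateral edge occur in both orders; the lateral-lateral block vanishes. *)
rewrite mul2n -addnn; congr (_ + _)%N.
rewrite exchange_big [X in (_ + X)%N]big1 ?addn0// => i _.
by rewrite big1// => j _; rewrite andbF.
Qed.

(** Inclusion-exclusion for each ordered pair: [far i j] and [far j i] hold together exactly for
    distinct parallel edges, and the diagonal vanishes by [far_irrefl]. *)
Lemma far_count :
  (\sum_i \sum_j ((i != j) && (far q s i j || far q s j i)) +
   \sum_i \sum_j ((i != j) && parallel_edges q i j) =
   2 * \sum_i \sum_j far q s i j)%N.
Proof.
rewrite mul2n -addnn [X in _ = (_ + X)%N]exchange_big -!big_split.
apply: eq_bigr => i _; rewrite -!big_split; apply: eq_bigr => j _ /=.
have [->|ij] := eqVneq i j.
  by rewrite (negPf (far_irrefl q_inj s0 q_adj q_left j)).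
have par : parallel_edges q i j = far q s i j && far q s j i.
  apply/idP/andP => [pij|[]]; last exact: far_parallel.
  split; apply: parallel_far => //; first by rewrite eq_sym.
  by rewrite parallel_edgesC.
by rewrite par; case: (far q s i j); case: (far q s j i).
Qed.

End PyramidFaces.

(** * The defect of a pyramid and the zero-defect criterion *)

Theorem theorem10p7 (R : realType) (n : nat) (q : 'I_n -> 'rV[R]_2)
    (o : 'rV[R]_3) (M : 'M[R]_(2, 3)) (apex : 'rV[R]_3)
    (hQ : convex_polygon q)
    (hadj : no_adjacent_collinear q)
    (hM : row_free M)
    (hapex : ~ range (place o M) apex) :
  defect (pyramid q o M apex) = (2 * num_parallel_edges q)%N%:Z /\
  (defect (pyramid q o M apex) = 0 <->
   ~ exists i j : 'I_n, i != j /\ parallel_edges q i j).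
Proof.
have [n2 q_inj _ _] := hQ.
have [s s0 q_left] := convex_polygon_left hQ.
pose i0 : 'I_n := Ordinal (ltn_trans (isT : (0 < 2)%N) n2).
have parE := @sum_sym_rel _ (@nat_of_ord n) _ (@ord_inj n) (@parallel_edgesC _ _ q).
have defE : defect (pyramid q o M apex) = (2 * num_parallel_edges q)%N%:Z.
  rewrite pyramidE /defect.
  have := num_vertices_pyramid hM hapex q_inj hadj s0 q_left.
  have := num_antipodal_vertices_pyramid hM hapex q_inj hadj s0 q_left i0.
  have := num_antipodal_edges_pyramid hM hapex q_inj hadj s0 q_left i0.
  have := far_count q_inj hadj s0 q_left.
  move: parE; rewrite -/(num_parallel_edges q).
  move: (num_vertices _) (num_antipodal_vertices _) (num_antipodal_edges _).
  move: (num_parallel_edges q) => p V A B.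
  (* With [S] the sum over antipodal base vertices, [T = 2p] that over parallel edges and [F] that
     of [far], twice the defect is [T + 2F - S = 2T = 4p], since [S + T = 2F]. *)
  by lia.
split=> //; rewrite defE; split=> [/eqP|nopar].
  rewrite eqz_nat muln_eq0 /= => /eqP/cards0_eq par0 [i [j [ij pij]]].
  wlog lt_ij : i j ij pij / (i < j)%N.
    move=> wl; have [|ltji|/ord_inj/eqP] := ltngtP i j; first exact: wl.
      by apply: wl ltji; rewrite 1?eq_sym// parallel_edgesC.
    by rewrite (negPf ij).
  by have := finset.in_set0 (i, j); rewrite -par0 inE /= lt_ij pij.
apply/eqP; rewrite eqz_nat muln_eq0 /= cards_eq0; apply/eqP/setP => -[i j].
rewrite !inE /=; apply/negP => /andP[lt_ij pij]; apply: nopar.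
by exists i, j; rewrite -val_eqE/= neq_ltn lt_ij.
Qed.
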